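(* Let $\{x_k\}$ and $\{\alpha_k\}$ be generated by the inexact proximal-gradient (PG) method described in the context. For any $\tau\in(0,1]$, the size of the set $\mathcal{K}_\tau:=\{k\in\mathbb{N}:\chi_k>\tau\}$ satisfies $$|\mathcal{K}^{\alpha}_{=}\cap\mathcal{K}_\tau|\le c_{pg}\,\tau^{-2},\qquad c_{pg}:=\frac{f(x_0)+r(x_0)-\inf_{x\in\mathbb{R}^n}\big(f(x)+r(x)\big)}{\eta\,\beta\,\alpha_{\min}},$$ where $\beta:=\gamma_1/2$ if Option 1 is used and $\beta:=1/4$ if Option 2 is used, and $$\alpha_{\min}:=\begin{cases}\min\big\{\alpha_0,\ \tfrac{3\gamma_1\zeta(1-\eta)}{L_g(1+\gamma_1)}\big\}&\text{if Option 1 is used,}\\[2pt] \min\big\{\alpha_0,\ \tfrac{\zeta(1-\eta)}{L_g}\big\}&\text{if Option 2 is used.}\end{cases}$$ Moreover, $$|\mathcal{K}_\tau|\le c^\alpha_\downarrow+c_{pg}\,\tau^{-2},\qquad c^\alpha_\downarrow:=\frac{\log(\alpha_{\min}/\alpha_0)}{\log(\zeta)}.$$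
   Context: $\|\cdot\|$ is the Euclidean norm and $\mathbb{N}=\{0,1,2,\dots\}$. The problem is $\min_{x\in\mathbb{R}^n} f(x)+r(x)$ with $f,r:\mathbb{R}^n\to\mathbb{R}$. Standing assumption: with $x_0$ the initial point and $\mathcal{L}:=\{x: f(x)+r(x)\le f(x_0)+r(x_0)\}$, $f$ is continuously differentiable and $\nabla f$ is Lipschitz continuous with constant $L_g$ on an open neighborhood containing $\mathcal{L}$; $r$ is closed, proper and convex; $f+r$ is bounded below. For $\bar x\in\mathbb{R}^n$, $\bar\alpha>0$ and $\epsilon\ge0$ set $\phi(x;\bar x,\bar\alpha):=\frac{1}{2\bar\alpha}\|x-(\bar x-\bar\alpha\nabla f(\bar x))\|^2+r(x)$, $T(\bar x,\bar\alpha):=\operatorname{argmin}_x\phi(x;\bar x,\bar\alpha)$, and $T_\epsilon(\bar x,\bar\alpha):=\{\hat x:\phi(\hat x;\bar x,\bar\alpha)\le\phi(T(\bar x,\bar\alpha);\bar x,\bar\alpha)+\epsilon\}$. Inexact PG method. Inputs/constants: $x_0\in\mathbb{R}^n$; a choice of Option 1 or Option 2 (fixed throughout); $\xi,\eta,\zeta\in(0,1)$; $\alpha_0\in(0,\infty)$; $\gamma_1\in(0,2)$; $\gamma_2\in(0,1/2]$. For $k=0,1,2,\dots$: (a) Option 1: choose $c_k\in\Big(0,\frac14\big(\sqrt{\tfrac{6}{(1+\gamma_1)\alpha_k}}-\sqrt{\tfrac{2}{\alpha_k}}\big)^2\Big]$; compute a triple $(\hat x_{k+1},s_k,\epsilon_k)$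 with $\hat x_{k+1}\in T_{\epsilon_k}(x_k,\alpha_k)$, $s_k=\hat x_{k+1}-x_k$, $\epsilon_k=c_k\|s_k\|^2$; set $\Delta_k=-\frac1{\alpha_k}\|s_k\|^2+\sqrt{2\epsilon_k/\alpha_k}\,\|s_k\|+\epsilon_k$. Option 2: compute a triple with $\hat x_{k+1}\in T_{\epsilon_k}(x_k,\alpha_k)$, $s_k=\hat x_{k+1}-x_k$, $\epsilon_k=\gamma_2\big(\phi(x_k;x_k,\alpha_k)-\phi(T(x_k,\alpha_k);x_k,\alpha_k)\big)$; set $\Delta_k=r(x_k+s_k)-r(x_k)+\nabla f(x_k)^Ts_k$. (b) Backtracking (while loop): let $j$ be the smallest nonnegative integer with $f(x_k+\xi^js_k)+r(x_k+\xi^js_k)\le f(x_k)+r(x_k)+\eta\xi^j\Delta_k$; set $x_{k+1}=x_k+\xi^js_k$. (c) If $j=0$, set $\alpha_{k+1}=\alpha_k$; if $j>0$, set $\alpha_{k+1}=\zeta\alpha_k$. $\mathcal{K}^{\alpha}_{=}$ is the set of $k\in\mathbb{N}$ for which $j=0$ in step (c), and $\mathcal{K}^{\alpha}_{\downarrow}$ is the set of $k$ for which $j>0$. The optimality measure is $\chi_k:=\|T(x_k,\alpha_k)-x_k\|/\alpha_k$; it is assumed throughout that $\chi_k>0$ for all $k\in\mathbb{N}$ (otherwise $x_k$ is an exact first-order solution). *)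

(* Defs.v *)
From HB Require Import structures.
From mathcomp Require Import all_boot all_order all_algebra finmap.
From mathcomp Require Import all_classical all_reals all_analysis.

Set Implicit Arguments.
Unset Strict Implicit.
Unset Printing Implicit Defensive.

Import Order.TTheory GRing.Theory Num.Theory.
Import numFieldNormedType.Exports.

Local Open Scope classical_set_scope.
Local Open Scope ring_scope.

Section Euclidean.
Context {R : realType} {n : nat}.
Implicit Types (u v x : 'rV[R]_n) (f : 'rV[R]_n -> R).

Definition dot u v : R := \sum_(i < n) u ord0 i * v ord0 i.

(* The library norm `|u| on 'rV[R]_n is the sup norm; it induces the same
   topology, but all quantitative statements below use this one. *)
Definition enorm u : R := Num.sqrt (dot u u).

Definition grad f x : 'rV[R]_n := \row_(i < n) 'D_(delta_mx ord0 i) f x.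

Definition continuously_differentiable f :=
  (forall x, differentiable f x) /\ continuous (grad f).

Definition lipschitz_grad_on f (L : R) (U : set 'rV[R]_n) :=
  forall x y, U x -> U y -> enorm (grad f x - grad f y) <= L * enorm (x - y).

(* Stated for extended-real-valued functions, as usual in convex analysis;
   both notions hold automatically for a finite convex function. *)
Definition closed_fun (g : 'rV[R]_n -> \bar R) :=
  closed [set p : 'rV[R]_n * R | (g p.1 <= p.2%:E)%E].

Definition proper_fun (g : 'rV[R]_n -> \bar R) :=
  (forall x, (-oo < g x)%E) /\ (exists x, (g x < +oo)%E).

End Euclidean.

Section InexactPG.
Context {R : realType} {n : nat}.
Variables (f r : 'rV[R]_n -> R).
Implicit Types (x s : 'rV[R]_n) (alpha eps : R).

Definition level_set x0 : set 'rV[R]_n :=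
  [set x | f x + r x <= f x0 + r x0].

Definition pg_phi (xb : 'rV[R]_n) (ab : R) (x : 'rV[R]_n) : R :=
  (2 * ab)^-1 * enorm (x - (xb - ab *: grad f xb)) ^+ 2 + r x.

(* For convex r and ab > 0, pg_phi xb ab is strongly convex and has exactly one
   minimizer, so the default value 0 is never used. *)
Definition pg_T (xb : 'rV[R]_n) (ab : R) : 'rV[R]_n :=
  xget 0 [set z | forall y, pg_phi xb ab z <= pg_phi xb ab y].

Definition pg_Teps eps (xb : 'rV[R]_n) (ab : R) : set 'rV[R]_n :=
  [set z | pg_phi xb ab z <= pg_phi xb ab (pg_T xb ab) + eps].

Definition pg_chi x alpha : R := enorm (pg_T x alpha - x) / alpha.

Variant pg_option := Option1 | Option2.

Definition pg_subproblem (opt : pg_option) (gamma1 gamma2 : R)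
    x alpha (xhat s : 'rV[R]_n) (eps Delta : R) : Prop :=
  [/\ pg_Teps eps x alpha xhat,
      s = xhat - x &
      match opt with
      | Option1 =>
          (exists2 c : R,
             0 < c <= 4^-1 * (Num.sqrt (6 / ((1 + gamma1) * alpha))
                              - Num.sqrt (2 / alpha)) ^+ 2
             & eps = c * enorm s ^+ 2)
          /\ Delta = - (alpha^-1 * enorm s ^+ 2)
                     + Num.sqrt (2 * eps / alpha) * enorm s + eps
      | Option2 =>
          eps = gamma2 * (pg_phi x alpha x - pg_phi x alpha (pg_T x alpha))
          /\ Delta = r (x + s) - r x + dot (grad f x) s
      end].

Definition pg_sufficient_decrease (xi eta : R) x s (Delta : R) (i : nat) :=
  f (x + xi ^+ i *: s) + r (x + xi ^+ i *: s)
    <= f x + r x + eta * xi ^+ i * Delta.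

(* j k is the number of backtracking steps made at iteration k; as in the
   method, the trial point computed at iteration k is xhat k.+1. *)
Record inexact_pg (opt : pg_option)
    (xi eta zeta alpha0 gamma1 gamma2 : R) (x0 : 'rV[R]_n)
    (x xhat s : nat -> 'rV[R]_n) (alpha eps Delta : nat -> R)
    (j : nat -> nat) : Prop := InexactPG {
  pg_x0 : x 0%N = x0;
  pg_alpha0 : alpha 0%N = alpha0;
  pg_trial : forall k, pg_subproblem opt gamma1 gamma2 (x k) (alpha k)
    (xhat k.+1) (s k) (eps k) (Delta k);
  pg_accept : forall k,
    pg_sufficient_decrease xi eta (x k) (s k) (Delta k) (j k);
  pg_smallest : forall k i, (i < j k)%N ->
    ~~ pg_sufficient_decrease xi eta (x k) (s k) (Delta k) i;
  pg_xS : forall k, x k.+1 = x k + xi ^+ j k *: s k;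
  pg_alphaS : forall k,
    alpha k.+1 = if j k == 0%N then alpha k else zeta * alpha k }.

Definition pg_Keq (j : nat -> nat) : set nat := [set k | j k = 0%N].

Definition pg_Ktau (x : nat -> 'rV[R]_n) (alpha : nat -> R) (tau : R) :
  set nat := [set k | tau < pg_chi (x k) (alpha k)].

Definition pg_beta (opt : pg_option) (gamma1 : R) : R :=
  match opt with Option1 => gamma1 / 2 | Option2 => 1 / 4 end.

Definition pg_alpha_min (opt : pg_option)
    (eta zeta alpha0 gamma1 Lg : R) : R :=
  match opt with
  | Option1 => Num.min alpha0
                 (3 * gamma1 * zeta * (1 - eta) / (Lg * (1 + gamma1)))
  | Option2 => Num.min alpha0 (zeta * (1 - eta) / Lg)
  end.

Definition pg_c_pg (opt : pg_option) (eta zeta alpha0 gamma1 Lg : R)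
    (x0 : 'rV[R]_n) : R :=
  (f x0 + r x0 - inf (range (fun x => f x + r x)))
  / (eta * pg_beta opt gamma1 * pg_alpha_min opt eta zeta alpha0 gamma1 Lg).

Definition pg_c_down (opt : pg_option) (eta zeta alpha0 gamma1 Lg : R) : R :=
  ln (pg_alpha_min opt eta zeta alpha0 gamma1 Lg / alpha0) / ln zeta.

End InexactPG.

(* The bound includes the finiteness of A: fset_set is empty on infinite sets. *)
Definition card_le_real {R : realType} (A : set nat) (b : R) :=
  finite_set A /\ (#|` fset_set A|%:R <= b)%R.

(* Main.v *)
Require Import Defs.
From HB Require Import structures.
From mathcomp Require Import all_boot all_order all_algebra finmap.
From mathcomp Require Import all_classical all_reals all_analysis.
From mathcomp Require Import ring lra.
Import Order.TTheory GRing.Theory Num.Theory.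
Import numFieldNormedType.Exports.
Local Open Scope classical_set_scope.
Local Open Scope ring_scope.

(** At an iteration let x be the iterate, alpha the step size, s the step,
    F = f + r the objective and z = pg_T x alpha the exact proximal point, so
    that chi = |z - x| / alpha. Everything follows from two properties of the
    predicted change Delta, valid for both options
    ([pg_subproblem_bounds]):

    - Delta is at least r (x + s) - r x + grad f x . s, the change of F with f
      linearized at x, and -Delta is at least kappa / 2 |s|^2 / alpha,
      with kappa = [pg_kappa];
    - -Delta is at least beta alpha chi^2.

    Both come from strong convexity of the proximal objective pg_phi: it grows
    like |y - z|^2 / (2 alpha) away from z ([prox_strong_min]), which converts
    near-optimality of x + s into a bound on the distance of x + s to z, and
    near-optimality is also tested on the segment from x + s to x
    ([inexact_step_decrease]). That z exists at all is [prox_min_exists]: r is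
    lower semicontinuous and, being convex, decreases at most linearly, so the
    quadratic term makes the sublevel sets compact.

    By the first property and the descent lemma, the full step passes the line
    search as soon as alpha <= kappa (1 - eta) / Lg ([small_stepsize_accepted]).
    The Lipschitz condition holds only on U, so the segment from x to x + s
    must be shown to stay in U; this is [level_set_segment], where the predicted
    decrease and convexity of r keep F from rising along the segment above its
    value at x. Hence alpha never
    falls below alpha_min ([pg_alpha_ge_min]), and since every reduction
    multiplies alpha by zeta, there are at most
    log (alpha_min / alpha0) / log zeta reductions.

    By the second property, an iteration with a full step and chi > tau lowers
    F by at least eta beta alpha_min tau^2, while no iteration raises F. As F
    is bounded below, the number of such iterations is at most c_pg / tau^2;
    the iterations with chi > tau that are not of this kind reduce alpha. *)

(** * Euclidean geometry of row vectors *)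

Section EuclideanSpace.
Context {R : realType} {n : nat}.
Implicit Types (u v w : 'rV[R]_n) (a b : R).

Lemma dotC u v : dot u v = dot v u.
Proof. by apply: eq_bigr => i _; rewrite mulrC. Qed.

Lemma dotDl u v w : dot (u + v) w = dot u w + dot v w.
Proof. by rewrite -big_split; apply: eq_bigr => i _; rewrite mxE mulrDl. Qed.

Lemma dotZl a u v : dot (a *: u) v = a * dot u v.
Proof. by rewrite mulr_sumr; apply: eq_bigr => i _; rewrite mxE mulrA. Qed.

Lemma dotNl u v : dot (- u) v = - dot u v.
Proof. by rewrite -scaleN1r dotZl mulN1r. Qed.

Lemma dotBl u v w : dot (u - v) w = dot u w - dot v w.
Proof. by rewrite dotDl dotNl. Qed.

Lemma dotDr u v w : dot u (v + w) = dot u v + dot u w.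
Proof. by rewrite dotC dotDl !(dotC u). Qed.

Lemma dotZr a u v : dot u (a *: v) = a * dot u v.
Proof. by rewrite dotC dotZl dotC. Qed.

Lemma dotNr u v : dot u (- v) = - dot u v.
Proof. by rewrite dotC dotNl dotC. Qed.

Lemma dot_ge0 u : 0 <= dot u u.
Proof. by apply: sumr_ge0 => i _; rewrite -expr2 sqr_ge0. Qed.

Lemma enorm_ge0 u : 0 <= enorm u.
Proof. exact: sqrtr_ge0. Qed.

Lemma enorm_sqr u : enorm u ^+ 2 = dot u u.
Proof. by rewrite sqr_sqrtr ?dot_ge0. Qed.

Lemma enorm_sqrD u v :
  enorm (u + v) ^+ 2 = enorm u ^+ 2 + 2 * dot u v + enorm v ^+ 2.
Proof. rewrite !enorm_sqr dotDl !dotDr (dotC v u); ring. Qed.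

Lemma enormZ a u : enorm (a *: u) = `|a| * enorm u.
Proof.
by rewrite /enorm dotZl dotZr mulrA -expr2 sqrtrM ?sqr_ge0// sqrtr_sqr.
Qed.

Lemma enormN u : enorm (- u) = enorm u.
Proof. by rewrite -scaleN1r enormZ normrN1 mul1r. Qed.

Lemma enormB_sym u v : enorm (u - v) = enorm (v - u).
Proof. by rewrite -enormN opprB. Qed.

Lemma coord_le_enorm u i : `|u ord0 i| <= enorm u.
Proof.
rewrite -(ler_pXn2r (ltn0Sn 1)) ?nnegrE ?enorm_ge0// enorm_sqr /dot.
rewrite (bigD1 i)//= real_normK ?num_real// expr2 lerDl.
by apply: sumr_ge0 => k _; rewrite -expr2 sqr_ge0.
Qed.

Lemma enorm_eq0 u : enorm u = 0 -> u = 0.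
Proof.
move=> u0; apply/rowP => i; rewrite mxE; apply/eqP.
by rewrite -normr_le0 -u0 coord_le_enorm.
Qed.

Lemma cauchy_schwarz u v : dot u v <= enorm u * enorm v.
Proof.
have [u0|u_neq0] := eqVneq (enorm u) 0.
  by rewrite u0 mul0r (enorm_eq0 _ u0) -(scale0r 0) dotZl mul0r.
have [v0|v_neq0] := eqVneq (enorm v) 0.
  by rewrite v0 mulr0 (enorm_eq0 _ v0) -(scale0r 0) dotZr mul0r.
have uv_gt0 : 0 < enorm u * enorm v.
  by rewrite mulr_gt0// lt_neqAle enorm_ge0 eq_sym ?u_neq0 ?v_neq0.
(* the combination whose squared norm is 2 |u| |v| (|u| |v| - u.v) *)
have := sqr_ge0 (enorm (enorm v *: u - enorm u *: v)).
rewrite enorm_sqrD enormN dotNr dotZl dotZr !enormZ.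
rewrite !(ger0_norm (enorm_ge0 _)) => h.
rewrite -subr_ge0 -(pmulr_rge0 _ uv_gt0); nra.
Qed.

Lemma enormD u v : enorm (u + v) <= enorm u + enorm v.
Proof.
rewrite -(ler_pXn2r (ltn0Sn 1)) ?nnegrE ?addr_ge0 ?enorm_ge0//.
have := cauchy_schwarz u v; rewrite enorm_sqrD; nra.
Qed.

Lemma le_norm_enorm u : `|u| <= enorm u.
Proof.
rewrite [leLHS]/Num.norm/= mx_normrE; apply: bigmax_le => [|[i k] _ /=].
  exact: enorm_ge0.
by rewrite ord1 coord_le_enorm.
Qed.

Lemma continuous_sum (T : topologicalType) (I : Type) (l : seq I)
    (F : I -> T -> R) :
  (forall i, continuous (F i)) -> continuous (fun x => \sum_(i <- l) F i x).
Proof.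
move=> Fc; elim: l => [|i l IH] x.
  under eq_fun do rewrite big_nil; exact: cvg_cst.
have -> : (fun y => \sum_(k <- i :: l) F k y)
    = F i \+ (fun y => \sum_(k <- l) F k y).
  by apply/funext => y; rewrite big_cons.
by apply: cvgD; [exact: Fc|exact: IH].
Qed.

Lemma enorm_sqr_continuous u : continuous (fun v => enorm (v - u) ^+ 2).
Proof.
rewrite (_ : (fun v => _) =
    fun v => \sum_(i < n) (v - u) ord0 i * (v - u) ord0 i).
  apply: continuous_sum => i v.
  have coordB : {for v, continuous (fun v : 'rV[R]_n => (v - u) ord0 i)}.
    rewrite (_ : (fun v => _) = (fun v => v ord0 i - u ord0 i)).
      by apply: continuousB; [exact: coord_continuous|exact: cst_continuous].
    by apply/funext => v'; rewrite !mxE.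
  exact: continuousM.
by apply/funext => v; rewrite enorm_sqr.
Qed.

End EuclideanSpace.

(** * The proximal subproblem *)

(** Closedness of the sublevel sets is lower semicontinuity. A minimizer is a
    point common to all the sets A and {g <= g y}, y in A, which have the finite
    intersection property because finitely many values g y have a least one. *)
Lemma compact_min_closed_sublevel (R : realType) (T : ptopologicalType)
    (A : set T) (g : T -> R) :
  A !=set0 -> compact A -> (forall c, closed [set x | g x <= c]) ->
  exists2 z, A z & forall y, A y -> g z <= g y.
Proof.
move=> A0 + clg; rewrite compact_In0 => cptA.
have [||z zA] := cptA T A (fun y => A `&` [set x | g x <= g y]).
- by exists (fun y => [set x | g x <= g y]) => // y _; exact: clg.
- move=> D subD.
  suff [z Az zD] : exists2 z, A z & forall y, y \in enum_fset D -> g z <= g y.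
    by exists z => y /= yD; split => //; exact: zD.
  have : forall y, y \in enum_fset D -> A y by move=> y /subD /set_mem.
  elim: (enum_fset D) => [_|y l IH sub]; first by case: A0 => a Aa; exists a.
  have [z Az zl] := IH (fun w wl => sub w (mem_behead (s := y :: l) wl)).
  have [yz|zy] := leP (g y) (g z).
    exists y; first by apply: sub; rewrite mem_head.
    by move=> w /[!inE] /predU1P[->//|/zl]; exact: le_trans.
  by exists z => // w /[!inE] /predU1P[->|/zl//]; exact: ltW.
have [a Aa] := A0.
by exists z => [|y Ay]; [have [] := zA a Aa|have [] := zA y Ay].
Qed.

Section Prox.
Context {R : realType} {n : nat}.
Variable r : 'rV[R]_n -> R.
Hypothesis r_closed : closed_fun (EFin \o r).
Hypothesis r_convex : @convex_function R 'rV[R]_n setT r.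
Implicit Types (u v w x y z : 'rV[R]_n) (a t c : R).

Lemma convex_segment x y t : 0 <= t <= 1 ->
  r (x + t *: (y - x)) <= r x + t * (r y - r x).
Proof.
move=> /andP[t0 t1].
have := r_convex (Itv01 t0 t1) y x (in_setT _) (in_setT _).
rewrite convRE /conv/= /unstable.onem => h.
have -> : x + t *: (y - x) = t *: y + (1 - t) *: x.
  by apply/rowP => i; rewrite !mxE; ring.
by apply: le_trans h _; rewrite le_eqVlt; apply/orP; left; apply/eqP; ring.
Qed.

(** The sublevel set at height c is the preimage of the epigraph of r under the
    continuous map sending x to (x, c - q x). *)
Lemma closed_sublevelD (q : 'rV[R]_n -> R) c :
  continuous q -> closed [set x | q x + r x <= c].
Proof.
move=> qc.
rewrite (_ : [set x | _] = (fun x => (x, c - q x)) @^-1`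
    [set p : 'rV[R]_n * R | ((EFin \o r) p.1 <= p.2%:E)%E]).
  apply: preimage_closed => // x _.
  have qx : {for x, continuous (fun x => c - q x)}.
    by apply: continuousB; [exact: cst_continuous|exact: qc].
  exact: (cvg_pair (f := id) cvg_id qx).
by apply/seteqP; split => x /=; rewrite lee_fin lerBrDl.
Qed.

Lemma bounded_enorm_ball w a : bounded_set [set x | enorm (x - w) <= a].
Proof.
exists (a + enorm w); split=> [|M aM x /= xw]; first exact: num_real.
apply: le_trans (le_norm_enorm x) _; apply: le_trans (ltW aM).
by rewrite -[x in enorm x](subrK w) (le_trans (enormD _ _))// lerD2r.
Qed.

Lemma closed_enorm_ball w a : 0 <= a -> closed [set x | enorm (x - w) <= a].
Proof.
move=> a0; rewrite (_ : [set x | _] =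
    (fun x => enorm (x - w) ^+ 2) @^-1` [set b | b <= a ^+ 2]).
  apply: preimage_closed => [x _|]; first exact: enorm_sqr_continuous.
  exact: closed_le.
by apply/seteqP; split => x /=; rewrite ler_pXn2r// nnegrE enorm_ge0.
Qed.

Lemma compact_enorm_ball w a : 0 <= a -> compact [set x | enorm (x - w) <= a].
Proof.
move=> a0; apply: bounded_closed_compact; first exact: bounded_enorm_ball.
exact: closed_enorm_ball.
Qed.

(** Semicontinuity bounds r from below on the unit ball around w; convexity on
    the ray from w through x then lets r decrease at most linearly. *)
Lemma convex_lower_growth w : exists C, forall x,
  - C * (1 + enorm (x - w)) <= r x.
Proof.
have [||c|z _ rz] := @compact_min_closed_sublevel R 'rV[R]_n
    [set x | enorm (x - w) <= 1] r.
- by exists w; rewrite /= subrr -(scale0r 0) enormZ normr0 mul0r.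
- exact: compact_enorm_ball.
- rewrite (_ : [set x | r x <= c] = [set x | 0 + r x <= c]).
    by apply: closed_sublevelD => x; exact: cst_continuous.
  by apply/seteqP; split => x /=; rewrite add0r.
exists (`|r z| + `|r w|) => x.
have := enorm_ge0 (x - w).
have := ler_norm (r w); have := ler_norm (- r z); rewrite normrN.
have := normr_ge0 (r w); have := normr_ge0 (r z).
set d := enorm (x - w) => h1 h2 h3 h4 d0.
have [d1|d1] := leP d 1; first by have := rz x d1; nra.
have dn0 : d != 0 by rewrite gt_eqF// (lt_trans ltr01).
have dV : 0 <= d^-1 <= 1.
  by rewrite invr_ge0 d0 invf_le1 ?(ltW d1)// (lt_trans ltr01).
have := convex_segment w x _ dV.
have /= := rz (w + d^-1 *: (x - w)).
rewrite [w + _]addrC addrK enormZ ger0_norm ?invr_ge0// mulVf// => /(_ (lexx _)).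
move=> /le_trans/[apply].
rewrite -(ler_pM2l (lt_trans ltr01 d1)) mulrDr mulrA divff// mul1r.
nra.
Qed.

(** The linear lower bound on r against the quadratic term makes the sublevel
    set of the objective at the height of w bounded, hence compact. *)
Lemma prox_min_exists w a : 0 < a ->
  exists z, forall y,
    (2 * a)^-1 * enorm (z - w) ^+ 2 + r z
      <= (2 * a)^-1 * enorm (y - w) ^+ 2 + r y.
Proof.
move=> a0; have [C growth] := convex_lower_growth w.
pose q x := (2 * a)^-1 * enorm (x - w) ^+ 2.
pose g x := q x + r x.
have qc : continuous q.
  move=> x; have := enorm_sqr_continuous w x.
  exact: (@continuousM _ _ (fun=> (2 * a)^-1) _ _ (@cst_continuous _ _ _ _)).
have clg c : closed [set x | g x <= c] by exact: closed_sublevelD.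
pose A := [set x | g x <= g w].
have cptA : compact A.
  apply: bounded_closed_compact; last exact: clg.
  (* for d = |x - w| > 1 the growth bound gives d^2 <= 2 a d (2 |C| + |g w|) *)
  pose K := 1 + 2 * a * (2 * `|C| + `|g w|).
  suff AK : A `<=` [set x | enorm (x - w) <= K].
    have [M [Mr MK]] := bounded_enorm_ball w K.
    by exists M; split=> // N /MK h x /AK /h.
  move=> x; rewrite /A/= => gxw; rewrite leNgt; apply/negP => Kd.
  have := growth x; move: gxw Kd.
  rewrite /g [q x]/q /K; have := enorm_ge0 (x - w).
  set d := enorm (x - w); set G := q w + r w => d0 gG Kd rC.
  have := ler_norm C; have := ler_norm G.
  have := normr_ge0 C; have := normr_ge0 G.
  move: `|C| `|G| Kd => c' g' Kd g0 c0 Gg Cc.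
  have dsq : d ^+ 2 <= 2 * a * (G - r x).
    by rewrite -ler_pdivrMl ?mulr_gt0// lerBrDr.
  have d1 : 1 < d by apply: le_lt_trans Kd; rewrite lerDl; nra.
  have : G - r x <= d * (2 * c' + g') by nra.
  rewrite -(ler_pM2l (_ : 0 < 2 * a)) ?mulr_gt0// => /(le_trans dsq).
  rewrite mulrCA expr2 ler_pM2l ?(lt_trans ltr01)//; lra.
have [|z Az zmin] := @compact_min_closed_sublevel R 'rV[R]_n A g _ cptA clg.
  by exists w; rewrite /A/=.
exists z => y; rewrite -/(q z) -/(q y) -/(g z) -/(g y).
by have [/zmin//|/ltW yw] := leP (g y) (g w); exact: le_trans yw.
Qed.

(** Compare z with the points of the segment from z to y: the identity
    |z + t (y - z) - w|^2 = (1-t)|z-w|^2 + t|y-w|^2 - t(1-t)|y-z|^2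
    turns convexity of r into strong convexity of the whole objective, and
    t is sent to 0. *)
Lemma prox_strong_min w a z : 0 < a ->
  (forall y, (2 * a)^-1 * enorm (z - w) ^+ 2 + r z
      <= (2 * a)^-1 * enorm (y - w) ^+ 2 + r y) ->
  forall y, (2 * a)^-1 * enorm (z - w) ^+ 2 + r z
      + (2 * a)^-1 * enorm (y - z) ^+ 2
      <= (2 * a)^-1 * enorm (y - w) ^+ 2 + r y.
Proof.
move=> a0 zmin y; set b := (2 * a)^-1 in zmin *.
have b0 : 0 < b by rewrite invr_gt0 mulr_gt0.
set gy := (X in _ <= X); set gz := (X in X + _ <= _).
have step t : 0 < t -> t <= 1 -> gz + (1 - t) * (b * enorm (y - z) ^+ 2) <= gy.
  move=> t0 t1; have := zmin (z + t *: (y - z)).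
  have := convex_segment z y t; rewrite (ltW t0) t1 => /(_ isT).
  have -> : z + t *: (y - z) - w = (z - w) + t *: (y - z) by rewrite addrAC.
  have := enorm_sqrD (z - w) (t *: (y - z)).
  have := enorm_sqrD (z - w) (y - z).
  rewrite [X in enorm X ^+ 2 = _]addrC addrA subrK => e1 ->.
  rewrite enormZ exprMn dotZr (ger0_norm (ltW t0)).
  move: e1; rewrite /gy /gz; set P := enorm (z - w) ^+ 2.
  set Q := enorm (y - z) ^+ 2; set S := dot _ _ => -> h1 h2.
  rewrite -(ler_pM2l t0); nra.
have B0 : 0 <= b * enorm (y - z) ^+ 2 by rewrite mulr_ge0 ?sqr_ge0// ltW.
move: step B0; set B := b * _ => step B0.
apply/ler_addgt0Pr => e e0.
have B1 : 0 < B + 1 by rewrite ltr_wpDl.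
(* this t satisfies t B <= e *)
have := step (Num.min 1 (e / (B + 1))).
rewrite lt_min ltr01 divr_gt0// ge_min lexx => /(_ isT isT).
have : Num.min 1 (e / (B + 1)) * B <= e.
  apply: (@le_trans _ _ (e / (B + 1) * (B + 1))); last by rewrite divfK// gt_eqF.
  apply: ler_pM => //;
    by rewrite ?le_min ?ler01 ?divr_ge0 ?ge_min ?lexx ?orbT ?lerDl ?ltW.
lra.
Qed.

End Prox.

(** * Descent along segments *)

Section Descent.
Context {R : realType} {n : nat}.
Variable f : 'rV[R]_n -> R.
Hypothesis f_C1 : continuously_differentiable f.
Implicit Types (x s : 'rV[R]_n) (t : R).

Lemma derive_dot_grad x s : 'D_s f x = dot (grad f x) s.
Proof.
have fx : differentiable f x by exact: f_C1.1.
rewrite deriveE// [in LHS](row_sum_delta s) linear_sum; apply: eq_bigr => i _.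
by rewrite linearZ/= -deriveE// mxE mulrC.
Qed.

Lemma is_derive_segment x s t :
  is_derive t 1 (fun t => f (x + t *: s)) (dot (grad f (x + t *: s)) s).
Proof.
rewrite -derive_dot_grad; set y := x + t *: s.
(* both directional derivatives are limits of the same difference quotients *)
have quotE : (fun h : R => h^-1 *: ((f \o shift y) (h *: s) - f y)) =
    (fun h : R => h^-1 *: (((fun t => f (x + t *: s)) \o shift t) (h *: 1)
      - f (x + t *: s))).
  apply/funext => h /=; congr (_ *: (f _ - _)).
  by rewrite /y addrCA -scalerDl scaler1.
have fy : derivable f y s by apply: diff_derivable; exact: f_C1.1.
split; first by rewrite /derivable -quotE.
by rewrite /derive -quotE.
Qed.

(** The gap between the quadratic model and f has, at parameter t, the slope
    t Lg |s|^2 - (grad f (x + t s) - grad f x) . s, which the Cauchy-Schwarz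
    inequality and the Lipschitz condition make nonnegative. *)
Lemma descent_lemma (Lg : R) (U : set 'rV[R]_n) x s :
  lipschitz_grad_on f Lg U ->
  (forall t, 0 <= t <= 1 -> U (x + t *: s)) ->
  f (x + s) <= f x + dot (grad f x) s + Lg / 2 * enorm s ^+ 2.
Proof.
move=> f_lip segU.
pose h t := f (x + t *: s) - t * dot (grad f x) s
  - Lg / 2 * enorm s ^+ 2 * t ^+ 2.
pose h' t := dot (grad f (x + t *: s)) s - dot (grad f x) s
   - Lg * enorm s ^+ 2 * t.
have dh t : is_derive t 1 h (h' t).
  pose a := dot (grad f x) s; pose C := Lg / 2 * enorm s ^+ 2.
  have did : is_derive t (1 : R) (@id R) 1 by exact: is_derive_id.
  have := is_deriveB (is_derive_segment x s t)
    (is_deriveD (is_deriveZ a did) (is_deriveZ C (is_deriveX 2 did))).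
  rewrite (_ : _ - _ = h) => [/is_derive_eq|]; last first.
    apply/funext => u; rewrite /h !fctE.
    change (f (x + u *: s) - (a * u + C * u ^+ 2)
      = f (x + u *: s) - u * a - C * u ^+ 2); ring.
  apply.
  change (dot (grad f (x + t *: s)) s - (a * 1 + C * (2%:R * t ^+ 1 * 1)) = h' t).
  by rewrite /h' /a /C; field.
have : h 1 <= h 0.
  apply: (@ler0_derive1_le_cc _ h 0 1) => //.
  - move=> t t01; rewrite derive1E (@derive_val _ _ _ _ _ _ _ (dh t)).
    move: t01; rewrite in_itv/= => /andP[t0 t1].
    have := f_lip (x + t *: s) x (segU t _) _.
    rewrite (ltW t0) (ltW t1) => /(_ isT).
    have Ux : U x.
      by rewrite -[x]addr0 -(scale0r s); apply: segU; rewrite lexx ler01.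
    move=> /(_ Ux); have -> : x + t *: s - x = t *: s by rewrite addrC addKr.
    rewrite enormZ (ger0_norm (ltW t0)) => glip.
    have := cauchy_schwarz (grad f (x + t *: s) - grad f x) s.
    rewrite dotBl /h'; have := enorm_ge0 s; nra.
  - apply: derivable_within_continuous => t _.
    exact: (@ex_derive _ _ _ _ _ _ _ (dh t)).
  - by rewrite in_itv/= lexx ler01.
  - by rewrite in_itv/= lexx ler01.
rewrite /h scale0r scale1r addr0; lra.
Qed.

(** The segment cannot leave U: at the first parameter a outside U, the descent
    lemma holds on [0, b] for every b < a and, with convexity of r, keeps the
    corresponding points in the level set, which is closed; so the point of
    parameter a would lie in the level set as well, hence in U. *)
Lemma level_set_segment (r : 'rV[R]_n -> R) (Lg : R) (U : set 'rV[R]_n) x0 x s :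
  closed_fun (EFin \o r) -> @convex_function R 'rV[R]_n setT r ->
  0 < Lg -> open U -> level_set f r x0 `<=` U -> lipschitz_grad_on f Lg U ->
  level_set f r x0 x ->
  r (x + s) - r x + dot (grad f x) s + Lg / 2 * enorm s ^+ 2 <= 0 ->
  forall t, 0 <= t <= 1 -> U (x + t *: s).
Proof.
move=> r_closed r_convex Lg0 U_open level_U f_lip xL model_le0.
have f_cont : continuous f.
  by move=> y; apply: differentiable_continuous; exact: f_C1.1.
have seg_cont : continuous (fun t : R => x + t *: s).
  move=> t; have sc := @scalel_continuous R 'rV[R]_n s t.
  exact: (@continuousD R 'rV[R]_n R (fun=> x) (fun t => t *: s) t
    (@cst_continuous _ _ _ _) sc).
pose E := [set t : R | 0 <= t <= 1] `&` [set t | (~` U) (x + t *: s)].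
have cptE : compact E.
  apply: (subclosed_compact _ (@segment_compact R 0 1)); last by move=> t [].
  apply: closedI.
    rewrite (_ : [set t | _] = `[0, 1]%classic); first exact: interval_closed.
    by apply/seteqP; split => t /=; rewrite in_itv.
  by apply: preimage_closed => [t _|]; [exact: seg_cont|exact: open_closedC].
apply: contrapT => /existsNP[t0 /not_implyP[t0_01 nUt0]].
have [|||a /set_mem[/andP[a0 a1] nUa] amin] := @compact_EVT_min R R id E.
- by exists t0; split.
- exact: cptE.
- by apply: continuous_subspaceT => t; exact: cvg_id.
have a_gt0 : 0 < a.
  rewrite lt_neqAle a0 andbT; apply/eqP => a_eq0; apply: nUa.
  by rewrite -a_eq0 scale0r addr0; exact: level_U.
have level_lt t : 0 <= t -> t < a -> level_set f r x0 (x + t *: s).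
  move=> t_ge0 ta.
  have Useg u : 0 <= u <= 1 -> U (x + u *: (t *: s)).
    move=> /andP[u0 u1]; rewrite scalerA; apply: contrapT => nU.
    have := amin (u * t); rewrite leNgt (le_lt_trans (ler_piMl _ u1))//.
    suff utE : u * t \in E by move=> /(_ utE).
    apply/mem_set; split => //=; rewrite mulr_ge0//= mulr_ile1//.
    by rewrite (le_trans (ltW ta)).
  have := descent_lemma _ _ _ _ f_lip Useg.
  rewrite dotZr enormZ exprMn (ger0_norm t_ge0) => fle.
  have t01 : 0 <= t <= 1 by rewrite t_ge0 (le_trans (ltW ta)).
  have := convex_segment _ r_convex x (x + s) _ t01.
  rewrite [X in _ *: X]addrC addKr => rle.
  move: xL model_le0 fle rle; rewrite /level_set/=.
  have := sqr_ge0 (enorm s); set S := enorm s ^+ 2; set D := dot _ _.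
  case/andP: t01 => _ t1 S0 xL model_le0 fle rle.
  have tS : Lg / 2 * (t ^+ 2 * S) <= t * (Lg / 2 * S).
    have LS : 0 <= Lg / 2 * S by rewrite mulr_ge0// divr_ge0// ltW.
    have -> : Lg / 2 * (t ^+ 2 * S) = t * (t * (Lg / 2 * S)) by ring.
    by rewrite ler_wpM2l// ler_piMl.
  nra.
(* the half-line t <= 0 is added so that C contains every t < a *)
pose C := [set t : R | t <= 0] `|` [set t | level_set f r x0 (x + t *: s)].
have closedC : closed C.
  apply: closedU; first exact: closed_le.
  apply: (@preimage_closed _ _ (fun t : R => x + t *: s)) => [t _|].
    exact: seg_cont.
  exact: closed_sublevelD.
have : C a.
  apply: closedC; have : closure [set t : R | t < a] a by rewrite closure_lt/=.
  apply: closure_subset => t /= ta.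
  by have [t_lt0|t_ge0] := ltP t 0; [left; exact: ltW|right; exact: level_lt].
by case=> [/=|/level_U//]; rewrite leNgt a_gt0.
Qed.

End Descent.

(** * Decrease predicted by one inexact proximal step *)

(** With this constant, the predicted change Delta of the objective is at most
    minus half of it times |s|^2 / alpha. *)
Definition pg_kappa {R : realType} (opt : pg_option) (gamma1 : R) : R :=
  match opt with Option1 => 3 * gamma1 / (1 + gamma1) | Option2 => 1 end.

Lemma pg_kappa_gt0 (R : realType) opt (gamma1 : R) :
  0 < gamma1 -> 0 < pg_kappa opt gamma1.
Proof. by case: opt => //= g0; rewrite divr_gt0 ?mulr_gt0 ?addr_gt0. Qed.

Lemma pg_alpha_minE (R : realType) opt (eta zeta alpha0 gamma1 Lg : R) :
  pg_alpha_min opt eta zeta alpha0 gamma1 Lg =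
  Num.min alpha0 (zeta * (pg_kappa opt gamma1 * (1 - eta) / Lg)).
Proof.
case: opt => /=; congr Num.min; last by rewrite mul1r mulrA.
by rewrite invfM; ring.
Qed.

(** With eps = c |s|^2, strong convexity places the trial point within q |s| of
    the exact proximal point, where q = sqrt (2 a c). The admissible range of c
    is the condition 1 + q <= sqrt (3 / (1 + gamma1)), once the factor
    sqrt (2 / a) is taken out of the two square roots. *)
Lemma option1_ratio (R : realType) (a c gamma1 : R) :
  0 < a -> 0 < gamma1 < 2 ->
  0 < c <= 4^-1 * (Num.sqrt (6 / ((1 + gamma1) * a)) - Num.sqrt (2 / a)) ^+ 2 ->
  let q := Num.sqrt (2 * a * c) in
  [/\ 0 < q, c = (2 * a)^-1 * q ^+ 2 & (1 + q) ^+ 2 <= 3 / (1 + gamma1)].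
Proof.
move=> a0 /andP[g0 g2] /andP[c0 cle] q.
have g1 : 0 < 1 + gamma1 by rewrite addr_gt0.
pose p := Num.sqrt (3 / (1 + gamma1)).
have p2 : p ^+ 2 = 3 / (1 + gamma1) by rewrite sqr_sqrtr// divr_ge0// ltW.
have p1 : 1 <= p.
  rewrite -(ler_pXn2r (ltn0Sn 1)) ?nnegrE ?sqrtr_ge0// p2 expr1n.
  by rewrite ler_pdivlMr// mul1r; lra.
have q2 : q ^+ 2 = 2 * a * c by rewrite sqr_sqrtr// !mulr_ge0// ltW.
have sqrtE : Num.sqrt (6 / ((1 + gamma1) * a)) = p * Num.sqrt (2 / a).
  by rewrite -sqrtrM ?divr_ge0 ?ltW//; congr Num.sqrt; field; rewrite !gt_eqF.
have q0 : 0 < q by rewrite sqrtr_gt0 !mulr_gt0.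
split => //; first by rewrite q2 mulKf// gt_eqF// mulr_gt0.
have qp : q ^+ 2 <= (p - 1) ^+ 2.
  rewrite q2; move: cle; rewrite sqrtE.
  rewrite (_ : p * _ - _ = Num.sqrt (2 / a) * (p - 1)); last by ring.
  rewrite exprMn sqr_sqrtr ?divr_ge0 ?(ltW a0)// => cle'.
  rewrite -ler_pdivlMl ?mulr_gt0// (le_trans cle')// le_eqVlt; apply/orP; left.
  by apply/eqP; field; rewrite gt_eqF.
rewrite -p2 ler_pXn2r// ?nnegrE ?addr_ge0 ?(ltW q0) ?(le_trans ler01 p1)//.
by rewrite addrC -lerBrDr -(ler_pXn2r (ltn0Sn 1))// nnegrE ?(ltW q0) ?subr_ge0.
Qed.

Section Iteration.
Context {R : realType} {n : nat}.
Variables f r : 'rV[R]_n -> R.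
Hypothesis r_closed : closed_fun (EFin \o r).
Hypothesis r_convex : @convex_function R 'rV[R]_n setT r.
Variables (x : 'rV[R]_n) (a : R).
Hypothesis a_gt0 : 0 < a.
Implicit Types s y : 'rV[R]_n.

Lemma pg_T_min y : pg_phi f r x a (pg_T f r x a) <= pg_phi f r x a y.
Proof.
have [z zmin] := prox_min_exists _ r_closed r_convex (x - a *: grad f x) _ a_gt0.
exact: (@xgetPex _ 0 [set z | forall y, pg_phi f r x a z <= pg_phi f r x a y]
  (ex_intro _ z zmin) y).
Qed.

Lemma pg_T_strong_min y :
  pg_phi f r x a (pg_T f r x a) + (2 * a)^-1 * enorm (y - pg_T f r x a) ^+ 2
    <= pg_phi f r x a y.
Proof. exact: prox_strong_min r_convex _ _ _ a_gt0 pg_T_min y. Qed.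

Lemma pg_phi_step s : pg_phi f r x a (x + s) = pg_phi f r x a x
  + (2 * a)^-1 * enorm s ^+ 2 + (r (x + s) - r x + dot (grad f x) s).
Proof.
rewrite /pg_phi; move: (grad f x) => g.
have -> : x + s - (x - a *: g) = s + a *: g.
  by apply/rowP => i; rewrite !mxE; ring.
have -> : x - (x - a *: g) = a *: g by rewrite subKr.
rewrite enorm_sqrD dotZr (dotC s).
by field; rewrite gt_eqF.
Qed.

(** Near-minimality of x + s is tested against the points of the segment from
    x + s back to x; t is the fraction of the way. *)
Lemma inexact_step_decrease s eps t :
  pg_phi f r x a (x + s) <= pg_phi f r x a (pg_T f r x a) + eps ->
  0 <= t <= 1 ->
  t * (r (x + s) - r x + dot (grad f x) s)
    <= eps - (2 * a)^-1 * (2 * t - t ^+ 2) * enorm s ^+ 2.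
Proof.
move=> near_min t01.
have := le_trans near_min (lerD (pg_T_min (x + (1 - t) *: s)) (lexx _)).
rewrite !pg_phi_step enormZ exprMn dotZr real_normK ?num_real//.
have := convex_segment _ r_convex (x + s) x _ t01.
have -> : x + s + t *: (x - (x + s)) = x + (1 - t) *: s.
  by rewrite opprD addNKr scalerN scalerBl scale1r addrA.
move: (r (x + (1 - t) *: s)) (pg_phi f r x a x) => ry ph rle phle; nra.
Qed.

Variables (gamma1 gamma2 : R).
Hypothesis gamma1_itv : 0 < gamma1 < 2.
Hypothesis gamma2_itv : 0 < gamma2 <= 1 / 2.

(** In terms of q, Delta = - (3 - (1 + q)^2) |s|^2 / (2 a), and the distance from
    x to the exact proximal point is at most (1 + q) |s|; both are controlled by
    (1 + q)^2 <= 3 / (1 + gamma1). *)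
Lemma option1_bounds xhat s eps Delta :
  pg_subproblem f r Option1 gamma1 gamma2 x a xhat s eps Delta ->
  [/\ r (x + s) - r x + dot (grad f x) s <= Delta,
      pg_kappa Option1 gamma1 / 2 * (enorm s ^+ 2 / a) <= - Delta &
      pg_beta Option1 gamma1 * a * pg_chi f r x a ^+ 2 <= - Delta].
Proof.
case=> + sE [[c c_itv epsE] DeltaE]; rewrite /pg_Teps/= => near_min.
have xhatE : xhat = x + s by rewrite sE addrC subrK.
have [q0 cE qle] := option1_ratio _ _ _ _ a_gt0 gamma1_itv c_itv.
move: (Num.sqrt _) q0 cE qle => q q0 cE qle.
have S0 := sqr_ge0 (enorm s).
have [g0 g2] := andP gamma1_itv.
have g1 : 0 < 1 + gamma1 by rewrite addr_gt0.
have q1 : q <= 1.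
  suff : 3 / (1 + gamma1) <= 3 by nra.
  by rewrite ler_pdivrMr// ler_pMr//; lra.
have DE : Delta = - ((2 * a)^-1 * (3 - (1 + q) ^+ 2) * enorm s ^+ 2).
  rewrite DeltaE epsE.
  have -> : 2 * (c * enorm s ^+ 2) / a = (q / a * enorm s) ^+ 2.
    by rewrite cE; field; rewrite gt_eqF.
  rewrite sqrtr_sqr ger0_norm ?mulr_ge0 ?enorm_ge0 ?invr_ge0 ?ltW// cE.
  by field; rewrite gt_eqF.
have epsE' : eps = (2 * a)^-1 * q ^+ 2 * enorm s ^+ 2 by rewrite epsE cE.
rewrite xhatE in near_min.
have b0 : 0 < (2 * a)^-1 by rewrite invr_gt0 mulr_gt0.
have gE : gamma1 * (3 / (1 + gamma1)) = 3 - 3 / (1 + gamma1).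
  by field; rewrite gt_eqF.
have bS0 : 0 <= (2 * a)^-1 * enorm s ^+ 2 by rewrite mulr_ge0// ltW.
split.
- (* t = q minimizes eps / t + (2 a)^-1 t |s|^2, as eps = (2 a)^-1 q^2 |s|^2 *)
  have := inexact_step_decrease _ _ q near_min.
  rewrite (ltW q0) q1 epsE' => /(_ isT) h.
  rewrite -(ler_pM2l q0) (le_trans h)// DE -subr_ge0.
  rewrite (_ : _ - _ = (2 * a)^-1 * enorm s ^+ 2 * q ^+ 3); last by ring.
  by rewrite mulr_ge0// exprn_ge0// ltW.
- rewrite DE opprK /pg_kappa.
  rewrite (_ : _ / 2 * _ =
    (2 * a)^-1 * enorm s ^+ 2 * (gamma1 * (3 / (1 + gamma1)))).
    by rewrite gE [leRHS]mulrAC ler_wpM2l// lerD2l lerN2.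
  by field; rewrite !gt_eqF.
- rewrite DE opprK /pg_beta /pg_chi.
  have dist : enorm (x + s - pg_T f r x a) <= q * enorm s.
    have := le_trans (pg_T_strong_min _) near_min.
    rewrite lerD2l epsE' -mulrA ler_pM2l// -exprMn ler_pXn2r//;
      by rewrite nnegrE ?mulr_ge0 ?enorm_ge0 ?ltW.
  have dist' : enorm (pg_T f r x a - x) <= (1 + q) * enorm s.
    have -> : pg_T f r x a - x = s - (x + s - pg_T f r x a).
      by apply/rowP => i; rewrite !mxE; ring.
    by rewrite (le_trans (enormD _ _))// enormN mulrDl mul1r lerD2l.
  have dist2 : enorm (pg_T f r x a - x) ^+ 2 <= 3 / (1 + gamma1) * enorm s ^+ 2.
    apply: (@le_trans _ _ ((1 + q) ^+ 2 * enorm s ^+ 2));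
      last by rewrite ler_wpM2r.
    rewrite -exprMn ler_pXn2r ?nnegrE ?enorm_ge0//.
    by rewrite (le_trans _ dist') ?enorm_ge0.
  rewrite [leLHS](_ : _ = (2 * a)^-1 * (gamma1 * enorm (pg_T f r x a - x) ^+ 2)).
    rewrite -[leRHS]mulrA ler_pM2l//.
    apply: (@le_trans _ _ (gamma1 * (3 / (1 + gamma1) * enorm s ^+ 2))).
      by rewrite ler_pM2l.
    by rewrite mulrA gE ler_wpM2r// lerD2l lerN2.
  by field; rewrite gt_eqF.
Qed.

(** As gamma2 <= 1/2, the trial point achieves at least half of the largest
    possible decrease P - Q of the proximal objective, and P - Q is at least
    |T - x|^2 / (2 a). *)
Lemma option2_bounds xhat s eps Delta :
  pg_subproblem f r Option2 gamma1 gamma2 x a xhat s eps Delta ->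
  [/\ r (x + s) - r x + dot (grad f x) s <= Delta,
      pg_kappa Option2 gamma1 / 2 * (enorm s ^+ 2 / a) <= - Delta &
      pg_beta Option2 gamma1 * a * pg_chi f r x a ^+ 2 <= - Delta].
Proof.
case=> + sE [epsE DE]; rewrite /pg_Teps/= => near_min.
have xhatE : xhat = x + s by rewrite sE addrC subrK.
move: near_min; rewrite xhatE pg_phi_step -DE epsE.
have := pg_T_strong_min x; rewrite enormB_sym.
(* P is the value at x and Q the minimum *)
move: (pg_phi f r x a x) (pg_phi f r x a _) => P Q growth near_min.
have b0 : 0 < (2 * a)^-1 by rewrite invr_gt0 mulr_gt0.
have S0 : 0 <= (2 * a)^-1 * enorm s ^+ 2 by rewrite mulr_ge0 ?sqr_ge0 ?ltW.
have Z0 : 0 <= (2 * a)^-1 * enorm (pg_T f r x a - x) ^+ 2.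
  by rewrite mulr_ge0 ?sqr_ge0 ?ltW.
have PQ : gamma2 * (P - Q) <= 1 / 2 * (P - Q).
  by case/andP: gamma2_itv => _ g2; apply: ler_wpM2r => //; lra.
have DeltaP : Delta <= - ((2 * a)^-1 * enorm s ^+ 2) - (P - Q) / 2 by lra.
split; first by rewrite DE.
- rewrite /pg_kappa (_ : 1 / 2 * _ = (2 * a)^-1 * enorm s ^+ 2); first by lra.
  by field; rewrite gt_eqF.
- rewrite /pg_beta /pg_chi.
  rewrite [leLHS](_ : _ = (2 * a)^-1 * enorm (pg_T f r x a - x) ^+ 2 / 2).
    by lra.
  by field; rewrite gt_eqF.
Qed.

Lemma pg_subproblem_bounds opt xhat s eps Delta :
  pg_subproblem f r opt gamma1 gamma2 x a xhat s eps Delta ->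
  [/\ r (x + s) - r x + dot (grad f x) s <= Delta,
      pg_kappa opt gamma1 / 2 * (enorm s ^+ 2 / a) <= - Delta &
      pg_beta opt gamma1 * a * pg_chi f r x a ^+ 2 <= - Delta].
Proof. by case: opt => [/option1_bounds|/option2_bounds]. Qed.

End Iteration.

(** * Counting iterations *)

(** A bound on the counts over all initial segments also gives finiteness: an
    infinite set has finite subsets of every size, each of them inside some
    initial segment. *)
Lemma card_le_real_count (R : realType) (A : set nat) (b : R) :
  (forall N, (count (mem A) (iota 0 N))%:R <= b) -> card_le_real A b.
Proof.
move=> countA.
have cardB (B : {fset nat}) : (forall k, k \in B -> A k) -> #|` B|%:R <= b.
  move=> BA; apply: le_trans (countA (\max_(k <- B) k).+1); rewrite ler_nat.
  rewrite -size_filter; apply: uniq_leq_size; first exact: fset_uniq.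
  move=> k kB; rewrite mem_filter mem_iota /= add0n ltnS leq_bigmax_seq// andbT.
  by apply/mem_set/BA.
have finA : finite_set A.
  apply: contrapT => infA.
  have [B BA sizeB] := infinite_set_fset (Num.truncn b).+1 infA.
  have := cardB B (fun k kB => BA k kB); rewrite leNgt => /negP; apply.
  by apply: (lt_le_trans (truncnS_gt b)); rewrite ler_nat.
split => //; apply: cardB => k.
by rewrite in_fset_set// => /set_mem.
Qed.

Lemma count_iotaS (A : set nat) N :
  count (mem A) (iota 0 N.+1) = (count (mem A) (iota 0 N) + (N \in A))%N.
Proof. by rewrite -addn1 iotaD count_cat/= addn0. Qed.

Lemma count_le_setIC (A B : set nat) N :
  (count (mem A) (iota 0 N)
    <= count (mem (~` B)) (iota 0 N) + count (mem (B `&` A)) (iota 0 N))%N.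
Proof.
rewrite -count_predUI; apply: leq_trans (leq_addr _ _).
apply: sub_count => k /=; move=> /set_mem Ak.
have [/set_mem Bk|/negP nBk] := boolP (k \in B).
  by apply/orP; right; apply/mem_set.
by apply/orP; left; apply/mem_set => Bk; apply: nBk; apply/mem_set.
Qed.

Section Run.
Context {R : realType} {n : nat}.
Variables (f r : 'rV[R]_n -> R) (x0 : 'rV[R]_n) (Lg : R) (U : set 'rV[R]_n).
Hypothesis f_C1 : continuously_differentiable f.
Hypothesis Lg_gt0 : 0 < Lg.
Hypothesis U_open : open U.
Hypothesis level_U : level_set f r x0 `<=` U.
Hypothesis f_lip : lipschitz_grad_on f Lg U.
Hypothesis r_closed : closed_fun (EFin \o r).
Hypothesis r_convex : @convex_function R 'rV[R]_n setT r.
Variables (opt : pg_option) (xi eta zeta alpha0 gamma1 gamma2 : R).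
Hypothesis xi01 : 0 < xi < 1.
Hypothesis eta01 : 0 < eta < 1.
Hypothesis zeta01 : 0 < zeta < 1.
Hypothesis alpha0_gt0 : 0 < alpha0.
Hypothesis gamma1_itv : 0 < gamma1 < 2.
Hypothesis gamma2_itv : 0 < gamma2 <= 1 / 2.

Let F x := f x + r x.
Let kappa := pg_kappa opt gamma1.
Let beta := pg_beta opt gamma1.
Let alpha_min := pg_alpha_min opt eta zeta alpha0 gamma1 Lg.

Let kappa_gt0 : 0 < kappa.
Proof. by apply: pg_kappa_gt0; case/andP: gamma1_itv. Qed.

Let beta_gt0 : 0 < beta.
Proof.
case/andP: gamma1_itv => g0 _; rewrite /beta; case: opt => /=;
  by rewrite divr_gt0.
Qed.

Lemma pg_alpha_min_gt0 : 0 < alpha_min.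
Proof.
case/andP: zeta01 => z0 _; case/andP: eta01 => _ e1.
rewrite /alpha_min pg_alpha_minE lt_min alpha0_gt0 mulr_gt0// divr_gt0//.
by rewrite mulr_gt0// subr_gt0.
Qed.

(** The quadratic term Lg / 2 |s|^2 of the descent lemma is absorbed by the
    fraction (1 - eta) Delta that the line search leaves aside. *)
Lemma small_stepsize_accepted x a xhat s eps Delta :
  0 < a -> a <= kappa * (1 - eta) / Lg -> level_set f r x0 x ->
  pg_subproblem f r opt gamma1 gamma2 x a xhat s eps Delta ->
  pg_sufficient_decrease f r xi eta x s Delta 0.
Proof.
move=> a0 a_small xL sub.
have [D_le S_le _] := pg_subproblem_bounds f r r_closed r_convex x a a0
  gamma1 gamma2 gamma1_itv gamma2_itv opt _ _ _ _ sub.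
case/andP: eta01 => e0 e1.
have S0 := sqr_ge0 (enorm s).
have Delta_le0 : Delta <= 0.
  rewrite -oppr_ge0 (le_trans _ S_le)// mulr_ge0// divr_ge0//; exact: ltW.
have quad : Lg / 2 * enorm s ^+ 2 <= (1 - eta) * - Delta.
  have e1' : 0 <= 1 - eta by rewrite subr_ge0 ltW.
  apply: le_trans (ler_wpM2l e1' S_le).
  have La : Lg * a <= kappa * (1 - eta) by rewrite mulrC -ler_pdivlMr.
  have Sa0 : 0 <= enorm s ^+ 2 / (2 * a) by rewrite divr_ge0// mulr_ge0// ltW.
  have := ler_wpM2r Sa0 La; rewrite [leLHS](_ : _ = Lg / 2 * enorm s ^+ 2).
    move/le_trans; apply; rewrite le_eqVlt; apply/orP; left; apply/eqP.
    by rewrite -/kappa; field; rewrite gt_eqF.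
  by field; rewrite gt_eqF.
have model : r (x + s) - r x + dot (grad f x) s + Lg / 2 * enorm s ^+ 2
    <= eta * Delta by nra.
have model0 : r (x + s) - r x + dot (grad f x) s + Lg / 2 * enorm s ^+ 2 <= 0.
  by apply: le_trans model _; rewrite pmulr_rle0.
have segU := level_set_segment f f_C1 r Lg U x0 x s r_closed r_convex Lg_gt0
  U_open level_U f_lip xL model0.
have := descent_lemma f f_C1 Lg U x s f_lip segU.
rewrite /pg_sufficient_decrease expr0 scale1r mulr1; lra.
Qed.

Variables (x xhat s : nat -> 'rV[R]_n) (alpha eps Delta : nat -> R).
Variable j : nat -> nat.
Hypothesis run : inexact_pg f r opt xi eta zeta alpha0 gamma1 gamma2 x0
             x xhat s alpha eps Delta j.

Lemma pg_alphaE N :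
  alpha N = zeta ^+ count (mem (~` pg_Keq j)) (iota 0 N) * alpha0.
Proof.
elim: N => [|N IH]; first by rewrite expr0 mul1r (pg_alpha0 run).
rewrite (pg_alphaS run) count_iotaS IH.
case: eqVneq => [j0|j_neq0].
  by rewrite memNset ?addn0// => /(_ j0).
by rewrite mem_set ?addn1 ?exprS ?mulrA// /pg_Keq/=; apply/eqP.
Qed.

Lemma pg_alpha_gt0 k : 0 < alpha k.
Proof.
by case/andP: zeta01 => z0 _; rewrite pg_alphaE mulr_gt0// exprn_gt0.
Qed.

Lemma pg_Delta_bounds k :
  beta * alpha k * pg_chi f r (x k) (alpha k) ^+ 2 <= - Delta k.
Proof.
by have [] := pg_subproblem_bounds f r r_closed r_convex (x k) (alpha k)
  (pg_alpha_gt0 k) gamma1 gamma2 gamma1_itv gamma2_itv opt _ _ _ _ (pg_trial run k).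
Qed.

Lemma pg_Delta_le0 k : Delta k <= 0.
Proof.
rewrite -oppr_ge0 (le_trans _ (pg_Delta_bounds k))//.
by rewrite mulr_ge0 ?sqr_ge0// mulr_ge0// ltW// pg_alpha_gt0.
Qed.

Lemma pg_monotone k : F (x k.+1) <= F (x k).
Proof.
rewrite (pg_xS run); apply: le_trans (pg_accept run k) _.
rewrite gerDl; case/andP: eta01 => e0 _; case/andP: xi01 => xi0 _.
by rewrite pmulr_rle0 ?pg_Delta_le0// mulr_gt0// exprn_gt0.
Qed.

Lemma pg_level k : level_set f r x0 (x k).
Proof.
elim: k => [|k IH]; first by rewrite /level_set/= (pg_x0 run).
exact: le_trans (pg_monotone k) IH.
Qed.

(** A step size is only shrunk when the full step is rejected, hence only from
    above the acceptance threshold. *)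
Lemma pg_alpha_ge_min k : alpha_min <= alpha k.
Proof.
case/andP: zeta01 => z0 z1.
elim: k => [|k IH].
  by rewrite (pg_alpha0 run) /alpha_min pg_alpha_minE ge_min lexx.
rewrite (pg_alphaS run); case: eqVneq => // j_neq0.
have j_gt0 : (0 < j k)%N by rewrite lt0n.
have := pg_smallest run j_gt0.
have [small|large _] := leP (alpha k) (kappa * (1 - eta) / Lg).
  by rewrite (small_stepsize_accepted _ _ _ _ _ _ (pg_alpha_gt0 k) small
    (pg_level k) (pg_trial run k)).
by rewrite /alpha_min pg_alpha_minE ge_min ler_pM2l// (ltW large) orbT.
Qed.

Lemma pg_full_step_decrease k tau : 0 < tau ->
  pg_Keq j k -> pg_Ktau f r x alpha tau k ->
  F (x k.+1) + eta * beta * alpha_min * tau ^+ 2 <= F (x k).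
Proof.
rewrite /pg_Keq/pg_Ktau/= => tau0 jk0 chi_tau.
have := pg_accept run k; rewrite (pg_xS run) jk0 /pg_sufficient_decrease expr0 mulr1.
case/andP: eta01 => e0 _.
have : beta * alpha_min * tau ^+ 2 <= - Delta k.
  apply: le_trans (pg_Delta_bounds k); rewrite -!mulrA ler_pM2l//.
  apply: ler_pM; first exact: ltW pg_alpha_min_gt0.
  - exact: sqr_ge0.
  - exact: pg_alpha_ge_min.
  by rewrite ler_pXn2r ?nnegrE ?ltW// (lt_trans tau0).
rewrite -(ler_pM2l e0) !mulrA mulrN /F; lra.
Qed.

Lemma pg_total_decrease tau N : 0 < tau ->
  F (x N) + (count (mem (pg_Keq j `&` pg_Ktau f r x alpha tau)) (iota 0 N))%:R
    * (eta * beta * alpha_min * tau ^+ 2) <= F x0.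
Proof.
move=> tau0; elim: N => [|N IH]; first by rewrite (pg_x0 run) mul0r addr0.
rewrite count_iotaS natrD mulrDl.
case: (boolP (N \in _)) => [/set_mem[jN chiN]|_] /=.
  by have := pg_full_step_decrease _ _ tau0 jN chiN; lra.
by have := pg_monotone N; lra.
Qed.

Lemma pg_count_full_steps tau N : 0 < tau ->
  has_lbound (range (fun x => f x + r x)) ->
  (count (mem (pg_Keq j `&` pg_Ktau f r x alpha tau)) (iota 0 N))%:R
    <= pg_c_pg f r opt eta zeta alpha0 gamma1 Lg x0 * tau ^- 2.
Proof.
move=> tau0 lbF; case/andP: eta01 => e0 _.
have tau2 : 0 < tau ^+ 2 by rewrite exprn_gt0.
rewrite /pg_c_pg -/beta -/alpha_min ler_pdivlMr// ler_pdivlMr; last first.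
  by rewrite !mulr_gt0// pg_alpha_min_gt0.
have := pg_total_decrease _ N tau0.
have : inf (range (fun x => f x + r x)) <= F (x N).
  by apply: ge_inf => //; exists (x N).
rewrite /F; lra.
Qed.

(** After m reductions the step size is zeta^m alpha0, which is at least
    alpha_min; take logarithms, ln zeta being negative. *)
Lemma pg_count_reductions N :
  (count (mem (~` pg_Keq j)) (iota 0 N))%:R
    <= pg_c_down opt eta zeta alpha0 gamma1 Lg.
Proof.
case/andP: zeta01 => z0 z1.
have := pg_alpha_ge_min N; rewrite pg_alphaE -ler_pdivrMr//.
rewrite -ler_ln ?posrE ?exprn_gt0 ?divr_gt0 ?pg_alpha_min_gt0//.
rewrite lnXn// => h.
by rewrite /pg_c_down -/alpha_min ler_ndivlMr ?mulr_natl// ln_lt0// z0.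
Qed.

End Run.

Theorem theorem3p7 (R : realType) (n : nat) (f r : 'rV[R]_n -> R)
    (x0 : 'rV[R]_n) (Lg : R) (U : set 'rV[R]_n)
    (f_C1 : continuously_differentiable f)
    (Lg_gt0 : 0 < Lg)
    (U_open : open U)
    (level_U : level_set f r x0 `<=` U)
    (f_lip : lipschitz_grad_on f Lg U)
    (r_closed : closed_fun (EFin \o r))
    (r_proper : proper_fun (EFin \o r))
    (r_convex : @convex_function R 'rV[R]_n setT r)
    (fr_bounded : has_lbound (range (fun x => f x + r x)))
    (opt : pg_option)
    (xi eta zeta alpha0 gamma1 gamma2 : R)
    (xi01 : 0 < xi < 1) (eta01 : 0 < eta < 1) (zeta01 : 0 < zeta < 1)
    (alpha0_gt0 : 0 < alpha0)
    (gamma1_itv : 0 < gamma1 < 2) (gamma2_itv : 0 < gamma2 <= 1 / 2)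
    (x xhat s : nat -> 'rV[R]_n) (alpha eps Delta : nat -> R) (j : nat -> nat)
    (run : inexact_pg f r opt xi eta zeta alpha0 gamma1 gamma2 x0
             x xhat s alpha eps Delta j)
    (chi_gt0 : forall k, 0 < pg_chi f r (x k) (alpha k))
    (tau : R) (tau_itv : 0 < tau <= 1) :
  card_le_real (pg_Keq j `&` pg_Ktau f r x alpha tau)
    (pg_c_pg f r opt eta zeta alpha0 gamma1 Lg x0 * tau ^- 2)
  /\
  card_le_real (pg_Ktau f r x alpha tau)
    (pg_c_down opt eta zeta alpha0 gamma1 Lg
     + pg_c_pg f r opt eta zeta alpha0 gamma1 Lg x0 * tau ^- 2).
Proof.
have tau0 : 0 < tau by case/andP: tau_itv.
have full N := pg_count_full_steps f r x0 Lg U f_C1 Lg_gt0 U_open level_U f_lip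
  r_closed r_convex opt xi eta zeta alpha0 gamma1 gamma2 xi01 eta01 zeta01
  alpha0_gt0 gamma1_itv gamma2_itv x xhat s alpha eps Delta j run tau N tau0
  fr_bounded.
have reductions N := pg_count_reductions f r x0 Lg U f_C1 Lg_gt0 U_open level_U
  f_lip r_closed r_convex opt xi eta zeta alpha0 gamma1 gamma2 xi01 eta01 zeta01
  alpha0_gt0 gamma1_itv gamma2_itv x xhat s alpha eps Delta j run N.
split; apply: card_le_real_count => N; first exact: full.
apply: le_trans (lerD (reductions N) (full N)).
by rewrite -natrD ler_nat count_le_setIC.
Qed.
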